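(* For any integer $m$ with $0 \le m \le 2N$, $$\left|\mathbb{P}(W = m) - \sum_{y=0}^{m}\mathbb{P}(Y=y)\,\mathbb{P}(Z=m-y)\right| \le \frac{8}{p^2}(1-p^2)^{N/4}.$$
   Context: Fix a real number $0<p<1$ and an integer $N\ge 0$. Let $A$ be a random subset of $\{0,\dots,N\}$ in which each integer $n\in\{0,\dots,N\}$ is included independently with probability $p$, and let $A+A=\{a+b : a,b\in A\}\subseteq\{0,\dots,2N\}$ ($a=b$ allowed). Define the random variables $Y=|\{0\le n\le N : n\notin A+A\}|$, $Z=|\{N+1\le n\le 2N : n\notin A+A\}|$, and $W=Y+Z=|\{0\le n\le 2N: n\notin A+A\}|$. *)

(* Defs.v *)
From mathcomp Require Export all_boot all_order all_algebra.
From mathcomp Require Export all_classical all_reals all_analysis.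

Set Implicit Arguments.
Unset Strict Implicit.
Unset Printing Implicit Defensive.

Import Order.TTheory GRing.Theory Num.Theory.

Local Open Scope classical_set_scope.
Local Open Scope ring_scope.

Definition independent_events (d : measure_display) (T : measurableType d)
    (R : realType) (P : probability T R) (I : finType) (E : I -> set T) : Prop :=
  forall J : {set I},
    P (\bigcap_(i in [set` J]) E i) = (\prod_(i in J) P (E i))%E.

Definition bernoulli_random_subset (d : measure_display) (T : measurableType d)
    (R : realType) (P : probability T R) (p : R) (N : nat)
    (A : T -> {set 'I_N.+1}) : Prop :=
  [/\ forall n, measurable [set w | n \in A w],
      forall n, P [set w | n \in A w] = p%:E
    & independent_events P (fun n => [set w | n \in A w])].

Definition sumset (N : nat) (S : {set 'I_N.+1}) : {set 'I_(2 * N).+1} :=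
  [set n : 'I_(2 * N).+1 |
    [exists a in S, exists b in S, (n : nat) == (a + b)%N]]%SET.

(* For N = 0 the range N + 1 <= n <= 2N is empty, so missing_high vanishes. *)
Definition missing_low (N : nat) (S : {set 'I_N.+1}) : nat :=
  #|[set n : 'I_(2 * N).+1 | (n <= N)%N & n \notin sumset S]%SET|.

Definition missing_high (N : nat) (S : {set 'I_N.+1}) : nat :=
  #|[set n : 'I_(2 * N).+1 | (N < n)%N & n \notin sumset S]%SET|.

Definition missing (N : nat) (S : {set 'I_N.+1}) : nat :=
  #|[set n : 'I_(2 * N).+1 | n \notin sumset S]%SET|.

(* Main.v *)
Require Import Defs.
From mathcomp Require Import all_boot all_order all_algebra.
From mathcomp Require Import all_classical all_reals all_analysis.
From mathcomp Require Import zify ring lra.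

Set Implicit Arguments.
Unset Strict Implicit.
Unset Printing Implicit Defensive.

Import Order.TTheory GRing.Theory Num.Theory.

Local Open Scope ring_scope.

(** Whether a small n is missing from A + A is decided by the elements of A
    near 0, and whether a large n is missing by the elements near N.  The
    counts Y and Z are thus almost functions of disjoint parts of A, and the
    error is controlled by the rarity of missing middle elements.

    Write q = 1 - p^2 and let h be the distance from n to the nearer end of
    [0, 2N].  There are at least h/2 disjoint pairs {a, b} with a + b = n, and
    n can only be missing if each of them fails to lie in A, so n is missing
    with probability at most q^(h/2) ([prob_notin_sumset]).

    Let K be N/2 rounded up.  Let Y' count the missing n < K and Z' the missing
    n > 2N - K.  The first depends on A below K only, the second on A above
    N - K only, and these ranges are disjoint, so Y' and Z' are independent
    ([prob_indep]).  Summing the geometric tail of q^(h/2) over h >= K, each of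
    Y <> Y' and Z <> Z' has probability at most e = (2/p^2) q^(K/2).

    Replacing (Y, Z) by (Y', Z') changes the law of Y + Z by at most 2e, and
    changes the convolution of the two laws by at most 2e as well; for the
    independent pair the two agree ([prob_sum_approx]).  The total error is
    4e = (8/p^2) q^(K/2), and K/2 >= N/4.

    All of this is a computation with finite sums over the subsets of [0, N];
    [random_subset_law] transports it to the given probability space. *)

(** * The product Bernoulli law on the subsets of a finite type *)

Section BernoulliLaw.
Variables (R : realFieldType) (I : finType) (p : R).
Hypotheses (p_ge0 : 0 <= p) (p_le1 : p <= 1).

Definition weight (S : {set I}) : R := \prod_i (if i \in S then p else 1 - p).

Definition prob (Q : pred {set I}) : R := \sum_(S | Q S) weight S.

Lemma weight_ge0 S : 0 <= weight S.
Proof. by apply: prodr_ge0 => i _; case: ifP => _ //; rewrite subr_ge0. Qed.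

Lemma eq_prob Q Q' : Q =1 Q' -> prob Q = prob Q'.
Proof. exact: eq_bigl. Qed.

Lemma prob_ge0 Q : 0 <= prob Q.
Proof. by apply: sumr_ge0 => S _; exact: weight_ge0. Qed.

Lemma prob_true : prob predT = 1.
Proof.
rewrite /prob -(bigA_distr 1 +%R (fun=> p) (fun=> 1 - p)).
by apply: big1 => i _ /=; rewrite addrC subrK.
Qed.

Lemma prob_sub (Q Q' : pred {set I}) :
  (forall S, Q S -> Q' S) -> prob Q <= prob Q'.
Proof.
move=> QQ'; rewrite /prob [leRHS](bigID Q) /=.
rewrite -[leLHS]addr0 lerD ?sumr_ge0 //; last by move=> *; exact: weight_ge0.
rewrite le_eqVlt; apply/orP; left; apply/eqP/eq_bigl => S.
by case QS: (Q S); rewrite ?andbF // andbT; apply/esym/QQ'.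
Qed.

Lemma probID (X Q : pred {set I}) :
  prob Q = prob (predI Q X) + prob (predI Q (predC X)).
Proof. exact: bigID. Qed.

Lemma probC Q : prob (predC Q) = 1 - prob Q.
Proof. by rewrite -prob_true (probID Q predT) addrAC subrr add0r. Qed.

Lemma prob_or Q Q' : prob (predU Q Q') <= prob Q + prob Q'.
Proof.
rewrite (probID Q (predU Q Q')); apply: lerD; apply: prob_sub => S.
  by case/andP.
by rewrite /= => /andP[/orP[->|]].
Qed.

Lemma prob_has (J : Type) (Q : J -> pred {set I}) (s : seq J) :
  prob (fun S => has (Q^~ S) s) <= \sum_(j <- s) prob (Q j).
Proof.
elim: s => [|j s IHs]; first by rewrite big_nil /prob big_pred0.
by rewrite big_cons; apply: le_trans (prob_or _ _) (lerD _ IHs).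
Qed.

(** Unlike the law of total probability, [s] need not exhaust the values of
    [X]: this form gives both the decomposition of {Y + Z = m} along Y <= m and
    the fact that point probabilities add up to at most 1. *)
Lemma prob_partition (X : {set I} -> nat) (s : seq nat) Q : uniq s ->
  \sum_(k <- s) prob (fun S => Q S && (X S == k)) =
  prob (fun S => Q S && (X S \in s)).
Proof.
elim: s => [|k s IHs] /=.
  by rewrite big_nil /prob big_pred0 // => S; rewrite andbF.
case/andP=> ks s_uniq; rewrite big_cons IHs //.
rewrite [RHS](probID (fun S => X S == k)); congr +%R; apply: eq_prob => S /=;
  rewrite inE; case: (eqVneq (X S) k) => [->|] /=; rewrite ?andbT ?andbF //.
by rewrite (negbTE ks) andbF.
Qed.

(** Take two independent random sets S and T, and exchange their traces outside
    U.  This involution on pairs preserves the product weight, because at each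
    point it at most swaps two factors.  It turns Q S and Q' T, whose joint
    probability is the product, into Q S and Q' S. *)
Lemma prob_indep (U : {set I}) (Q Q' : pred {set I}) :
  (forall S, Q S = Q (S :&: U)) -> (forall S, Q' S = Q' (S :\: U)) ->
  prob (predI Q Q') = prob Q * prob Q'.
Proof.
move=> QU QU'.
pose swap (ST : {set I} * {set I}) :=
  ((ST.1 :&: U) :|: (ST.2 :\: U), (ST.2 :&: U) :|: (ST.1 :\: U)).
have swapK : involutive swap.
  move=> [S T]; rewrite /swap /=.
  by congr pair; apply/setP => i; rewrite !inE; case: (i \in U);
     case: (i \in S); case: (i \in T).
have swap_weight S T :
    weight (swap (S, T)).1 * weight (swap (S, T)).2 = weight S * weight T.
  rewrite /weight -!big_split /=; apply: eq_bigr => i _; rewrite !inE.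
  by case: (i \in U); rewrite /= ?andbT ?andbF ?orbF //= mulrC.
rewrite /prob big_distrlr pair_big (reindex_inj (inv_inj swapK)) /=.
transitivity (\sum_(ST : {set I} * {set I} | predI Q Q' ST.1 && true)
    weight ST.1 * weight ST.2).
  rewrite -(pair_big (predI Q Q') predT (fun S T => weight S * weight T)) /=.
  by apply: eq_bigr => S _; rewrite -mulr_sumr -/(prob predT) prob_true mulr1.
apply: eq_big => [[S T]|[S T] _] /=; last exact/esym/swap_weight.
by rewrite andbT QU QU' [in RHS]QU [in RHS]QU'; congr (Q _ && Q' _);
   apply/setP => i; rewrite !inE; case: (i \in U); case: (i \in S);
   case: (i \in T).
Qed.

(** The sum over S is the expansion of a product in which each i in B must choose
    the factor p, while each other i contributes p + (1 - p) = 1. *)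
Lemma prob_superset (B : {set I}) : prob (fun S => B \subset S) = p ^+ #|B|.
Proof.
pose F (i : I) : R := p; pose G (i : I) : R := if i \in B then 0 else 1 - p.
transitivity (\prod_i (F i + G i)).
  rewrite /prob bigA_distr [LHS]big_mkcond; apply: eq_bigr => S _.
  case: ifPn => [/fintype.subsetP BS | /fintype.subsetPn[i iB iS]].
    apply: eq_bigr => i _; rewrite /F /G; case: ifPn => // iS.
    by rewrite (contraNF (BS i)).
  by rewrite (bigD1 i) //= /G (negbTE iS) iB mul0r.
rewrite -prodr_const [RHS]big_mkcond; apply: eq_bigr => i _; rewrite /F /G.
by case: ifP; rewrite ?addr0 // addrC subrK.
Qed.

(** Disjoint sets B are contained in S independently of each other. *)
Lemma prob_no_superset (Bs : seq {set I}) :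
  pairwise (fun B C : {set I} => [disjoint B & C]) Bs ->
  prob (fun S => all (fun B : {set I} => ~~ (B \subset S)) Bs) =
  \prod_(B <- Bs) (1 - p ^+ #|B|).
Proof.
elim: Bs => [|B Bs IHs] /=; first by rewrite big_nil prob_true.
case/andP=> /allP BBs Bs_disj; rewrite big_cons -IHs // -prob_superset -probC.
apply: (@prob_indep B) => S.
  by rewrite /= finset.subsetI fintype.subxx andbT.
apply: eq_in_all => C /BBs; rewrite disjoint_sym => CB.
by rewrite finset.subsetD CB andbT.
Qed.

Lemma prob_eq_dist (X X' : {set I} -> nat) k :
  `|prob (fun S => X S == k) - prob (fun S => X' S == k)| <=
  prob (fun S => X S != X' S).
Proof.
have dist1 X1 X2 : prob (fun S => X1 S == k) - prob (fun S => X2 S == k) <=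
    prob (fun S => X1 S != X2 S).
  rewrite lerBlDr; apply: le_trans (prob_or _ _); apply: prob_sub => S.
  by rewrite /= => /eqP->; rewrite eq_sym orNb.
rewrite ler_norml dist1 andbT lerNl opprB.
rewrite (@eq_prob (fun S => X S != _) (fun S => X' S != X S)) // => S.
by rewrite eq_sym.
Qed.

Lemma sum_prob_le1 (X : {set I} -> nat) (s : seq nat) :
  uniq s -> \sum_(k <- s) prob (fun S => X S == k) <= 1.
Proof.
move=> s_uniq; rewrite -prob_true.
have /= -> := prob_partition X predT s_uniq.
exact: prob_sub.
Qed.

(** Approximating Y and Z by an independent pair Y', Z' makes two errors: one on
    the law of Y + Z, one on the convolution of the laws of Y and Z.  The second
    is bounded by changing one factor at a time, the other factor summing to at
    most 1; this avoids any loss proportional to m. *)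
Lemma prob_sum_approx (Y Z Y' Z' : {set I} -> nat) (m : nat) :
  (forall a b, prob (fun S => (Y' S == a) && (Z' S == b)) =
     prob (fun S => Y' S == a) * prob (fun S => Z' S == b)) ->
  `|prob (fun S => Y S + Z S == m)%N -
    \sum_(0 <= y < m.+1)
      prob (fun S => Y S == y) * prob (fun S => Z S == m - y)%N| <=
  2 * (prob (fun S => Y S != Y' S) + prob (fun S => Z S != Z' S)).
Proof.
move=> indep; set eY := prob (fun S => Y S != _);
  set eZ := prob (fun S => Z S != _).
set s := index_iota 0 m.+1.
have s_uniq : uniq s by exact: iota_uniq.
have sumYZ' : prob (fun S => Y' S + Z' S == m)%N = \sum_(y <- s)
    prob (fun S => Y' S == y) * prob (fun S => Z' S == m - y)%N.
  under eq_bigr do rewrite -indep.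
  have /= E := prob_partition Y' (fun S => Y' S + Z' S == m)%N s_uniq.
  transitivity (prob (fun S => (Y' S + Z' S == m)%N && (Y' S \in s))).
    by apply: eq_prob => S; rewrite mem_index_iota; lia.
  rewrite -E; apply: eq_big_seq => y; rewrite mem_index_iota => ym.
  by apply: eq_prob => S; lia.
have distYZ : `|prob (fun S => Y S + Z S == m)%N -
    prob (fun S => Y' S + Z' S == m)%N| <= eY + eZ.
  apply: le_trans (prob_eq_dist (fun S => Y S + Z S)%N
                                (fun S => Y' S + Z' S)%N m) _.
  apply: le_trans (prob_or _ _); apply: prob_sub => S.
  by rewrite /=; lia.
have distprod : `|prob (fun S => Y' S + Z' S == m)%N - \sum_(y <- s)
    prob (fun S => Y S == y) * prob (fun S => Z S == m - y)%N| <= eY + eZ.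
  rewrite sumYZ' -sumrB.
  under eq_bigr => y _.
    rewrite (_ : _ - _ =
      (prob (fun S => Y' S == y) - prob (fun S => Y S == y)) *
        prob (fun S => Z S == m - y)%N
      + prob (fun S => Y' S == y) *
        (prob (fun S => Z' S == m - y)%N - prob (fun S => Z S == m - y)%N)).
    over.
    by ring.
  apply: le_trans (ler_norm_sum _ _ _) _.
  apply: (@le_trans _ _ (\sum_(y <- s) (eY * prob (fun S => Z S == m - y)%N
      + prob (fun S => Y' S == y) * eZ))).
    apply: ler_sum => y _; apply: le_trans (ler_normD _ _) _.
    rewrite !normrM !(ger0_norm (prob_ge0 _)) distrC.
    rewrite (distrC (prob (fun S => Z' S == _))).
    by apply: lerD; [apply: ler_wpM2r | apply: ler_wpM2l];
       rewrite ?prob_ge0 ?prob_eq_dist.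
  rewrite big_split /= -mulr_sumr -mulr_suml; apply: lerD.
    rewrite ler_piMr ?prob_ge0 //.
    have -> : \sum_(y <- s) prob (fun S => Z S == m - y)%N =
        \sum_(z <- s) prob (fun S => Z S == z).
      by rewrite [RHS]big_nat_rev add0n.
    exact: sum_prob_le1.
  by rewrite ler_piMl ?prob_ge0 ?sum_prob_le1.
apply: le_trans (ler_distD (prob (fun S => Y' S + Z' S == m)%N) _ _) _.
by rewrite mulr_natl mulr2n lerD.
Qed.
End BernoulliLaw.

(** * Missing elements of the sumset *)

Definition missing_in (N : nat) (D : pred nat) (S : {set 'I_N.+1}) : nat :=
  #|[set n : 'I_(2 * N).+1 | D n & n \notin sumset S]%SET|.

Lemma sumsetP (N : nat) (S : {set 'I_N.+1}) (n : 'I_(2 * N).+1) :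
  reflect (exists a b : 'I_N.+1, [/\ a \in S, b \in S & (n : nat) = (a + b)%N])
    (n \in sumset S).
Proof.
rewrite inE; apply: (iffP existsP) => [[a /andP[aS /existsP[b /andP[bS /eqP]]]]|].
  by exists a, b.
case=> a [b [aS bS nab]]; exists a; rewrite aS /=; apply/existsP; exists b.
by rewrite bS nab eqxx.
Qed.

Lemma missing_low_high (N : nat) (S : {set 'I_N.+1}) :
  missing S = (missing_low S + missing_high S)%N.
Proof.
rewrite /missing -(cardsID [set n : 'I_(2 * N).+1 | n <= N]%N%SET).
by congr addn; apply: eq_card => n; rewrite !inE ?ltnNge 1?andbC.
Qed.

(** As D constrains the sum symmetrically in a and b, a condition on the first
    term alone puts both terms of every decomposition in V. *)
Lemma missing_in_local (N : nat) (D : pred nat) (V S : {set 'I_N.+1}) :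
  (forall a b : 'I_N.+1, D (a + b)%N -> a \in V) ->
  missing_in D S = missing_in D (S :&: V).
Proof.
move=> DV; apply: eq_card => n; rewrite inE [RHS]inE; case Dn: (D n) => //=.
congr negb; apply/sumsetP/sumsetP => -[a [b [aS bS nab]]]; exists a, b.
  rewrite !inE aS bS nab (DV a b) ?(DV b a) //; first by rewrite addnC -nab.
  by rewrite -nab.
by move: aS bS; rewrite !inE => /andP[-> _] /andP[-> _].
Qed.

Lemma missing_in_neq (N : nat) (D D' : pred nat) (S : {set 'I_N.+1}) :
  missing_in D S != missing_in D' S ->
  exists2 n : 'I_(2 * N).+1, D n != D' n & n \notin sumset S.
Proof.
move=> neq; apply/exists_inP; apply: contraNT neq => /exists_inPn noD.
apply/eqP/eq_card => n; rewrite !inE.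
case: (boolP (D n == D' n)) => [/eqP-> //|/noD].
by rewrite negbK inE => ->; rewrite !andbF.
Qed.

Section MissingProb.
Variables (R : realFieldType) (p : R).
Hypotheses (p_gt0 : 0 < p) (p_lt1 : p < 1).
Let q := 1 - p ^+ 2.

Lemma q_ge0 : 0 <= q.
Proof. by rewrite subr_ge0 expr_le1 ?ltW. Qed.

(** The disjoint pairs witnessing n are {lo + a, n - lo - a}, where the shift
    lo = n - N (truncated) keeps both elements inside [0, N]; then
    n - 2 lo is the distance h from n to the nearer end.  For even h the middle
    element, which would be paired with itself, is left out. *)
Lemma prob_notin_sumset (N : nat) (n : 'I_(2 * N).+1) :
  prob p (fun S : {set 'I_N.+1} => n \notin sumset S) <=
  q ^+ uphalf (minn n (2 * N - n)).
Proof.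
set h := minn _ _; have n_le := ltn_ord n.
pose lo := (n - N)%N.
pose pair_of a : {set 'I_N.+1} := [set inord (lo + a); inord (n - lo - a)].
pose Bs := [seq pair_of a | a <- iota 0 (uphalf h)].
have inordE k : (k <= N)%N -> (inord k : 'I_N.+1) = k :> nat.
  by move=> kN; rewrite inordK.
have Bs_card B : B \in Bs -> #|B| = 2.
  case/mapP => a; rewrite mem_iota => /andP[_ ah] ->; rewrite cards2.
  by rewrite -val_eqE /= !inordE; lia.
have Bs_disj : pairwise (fun B C : {set 'I_N.+1} => [disjoint B & C]) Bs.
  apply/(pairwiseP finset.set0) => i j; rewrite !inE size_map size_iota => ih jh ij.
  rewrite !(nth_map 0%N) ?size_iota // !nth_iota // !add0n.
  rewrite finset.disjoints_subset; apply/fintype.subsetP => x.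
  by rewrite !inE -!val_eqE /= !inordE; lia.
have -> : q ^+ uphalf h = \prod_(B <- Bs) (1 - p ^+ #|B|).
  rewrite (eq_big_seq (fun=> q)) => [|B /Bs_card -> //].
  by rewrite big_const_seq count_predT size_map size_iota iter_mulr_1.
rewrite -(prob_no_superset p Bs_disj); apply: prob_sub; try exact: ltW.
move=> S nS; apply/allP => _ /mapP[a + ->]; rewrite mem_iota => ah.
apply: contraNN nS; rewrite finset.subUset !finset.sub1set => /andP[aS bS].
by apply/sumsetP; exists (inord (lo + a)), (inord (n - lo - a));
   split=> //; rewrite !inordE; lia.
Qed.

(** With e_j = q^(uphalf j), the identity (1 - q) e_j = e_j - e_{j+2} makes
    p^2 times the sum telescope to at most e_K + e_{K+1} <= 2 e_K. *)
Lemma sum_exp_uphalf (K L : nat) : (K <= L)%N ->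
  \sum_(K <= j < L) q ^+ uphalf j <= 2 / p ^+ 2 * q ^+ uphalf K.
Proof.
move=> KL; have p2_gt0 : 0 < p ^+ 2 by rewrite exprn_gt0.
have q_le1 : q <= 1 by rewrite gerBl ltW.
rewrite mulrAC ler_pdivlMr // mulr_suml.
pose t j := - (q ^+ uphalf j + q ^+ uphalf j.+1).
rewrite (eq_bigr (fun j => t j.+1 - t j)) => [|j _]; last first.
  by rewrite /t /= !exprS /q; ring.
rewrite telescope_sumr // /t opprK.
apply: (@le_trans _ _ (q ^+ uphalf K + q ^+ uphalf K.+1)).
  by rewrite gerDr oppr_le0 addr_ge0 ?exprn_ge0 ?q_ge0.
by rewrite mulr_natl mulr2n lerD2l; apply: ler_wiXn2l; rewrite ?q_ge0 //; lia.
Qed.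

(** The map [phi] enumerates the region where D and D' differ by distance to the
    nearer end, so that the lower and the upper half of [0, 2N] are treated by
    the same union bound. *)
Lemma prob_missing_in_neq (N K L : nat) (D D' : pred nat)
    (phi : nat -> 'I_(2 * N).+1) :
  (K <= L)%N ->
  (forall n : 'I_(2 * N).+1, D n != D' n ->
    exists2 j, (K <= j < L)%N & n = phi j) ->
  (forall j, (K <= j < L)%N -> minn (phi j) (2 * N - phi j) = j) ->
  prob p (fun S : {set 'I_N.+1} => missing_in D S != missing_in D' S) <=
  2 / p ^+ 2 * q ^+ uphalf K.
Proof.
move=> KL DD' phi_min; apply: le_trans (sum_exp_uphalf KL).
have [p_ge0 p_le1] := (ltW p_gt0, ltW p_lt1).
apply: (@le_trans _ _ (\sum_(j <- index_iota K L)
    prob p (fun S : {set 'I_N.+1} => phi j \notin sumset S))).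
  apply: le_trans (prob_has p_ge0 p_le1 _ _); apply: prob_sub => // S.
  case/missing_in_neq => n /DD'[j jKL ->] nS; apply/hasP; exists j => //.
  by rewrite mem_index_iota.
rewrite big_seq [leRHS]big_seq; apply: ler_sum => j; rewrite mem_index_iota.
by move=> /phi_min {2}<-; exact: prob_notin_sumset.
Qed.

Lemma prob_missing_approx (N m : nat) :
  `|prob p (fun S : {set 'I_N.+1} => missing S == m) -
    \sum_(0 <= y < m.+1)
      prob p (fun S : {set 'I_N.+1} => missing_low S == y) *
      prob p (fun S : {set 'I_N.+1} => missing_high S == (m - y)%N)| <=
  8 / p ^+ 2 * q ^+ uphalf (uphalf N).
Proof.
set K := uphalf N.
pose low := @missing_in N (fun n => n < K)%N.
pose high := @missing_in N (fun n => 2 * N < n + K)%N.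
have low_err : prob p (fun S => missing_low S != low S) <=
    2 / p ^+ 2 * q ^+ uphalf K.
  apply: (@prob_missing_in_neq N K N.+1 (leq^~ N) _ inord); first by lia.
    move=> n n_range; exists (n : nat); first by move: n_range; lia.
    by rewrite inord_val.
  by move=> j jKN; rewrite inordK; lia.
have high_err : prob p (fun S => missing_high S != high S) <=
    2 / p ^+ 2 * q ^+ uphalf K.
  apply: (@prob_missing_in_neq N K N (fun n => N < n)%N _
      (fun j => inord (2 * N - j))); first by lia.
    move=> n n_range; exists (2 * N - n)%N; have := ltn_ord n.
      by move: n_range; lia.
    by move=> n_le; apply: val_inj; rewrite /= inordK; lia.
  by move=> j jKN; rewrite inordK; lia.
have indep a b : prob p (fun S => (low S == a) && (high S == b)) =
    prob p (fun S => low S == a) * prob p (fun S => high S == b).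
  apply: (@prob_indep _ _ p [set i : 'I_N.+1 | i < K]%N%SET) => S.
    by rewrite /low -missing_in_local // => i j; rewrite inE; lia.
  (* A sum above 2N - K forces both terms above N - K >= K - 1. *)
  rewrite finset.setDE /high -missing_in_local // => i j; rewrite !inE.
  by have := ltn_ord i; have := ltn_ord j; lia.
have [p_ge0 p_le1] := (ltW p_gt0, ltW p_lt1).
have := prob_sum_approx p_ge0 p_le1 (@missing_low N) (@missing_high N) m indep.
under eq_prob do rewrite -missing_low_high.
by move/le_trans; apply; lra.
Qed.
End MissingProb.

Local Open Scope classical_set_scope.

(** * The law of a Bernoulli random subset *)

Lemma disjoints_setU1 (I : finType) (k : I) (K B : {set I}) :
  [disjoint (k |: K)%SET & B]%B = (k \notin B) && [disjoint K & B]%B.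
Proof.
by rewrite !finset.disjoints_subset finset.subUset finset.sub1set inE.
Qed.

Section LawOfRandomSubset.
Variables (R : realType) (p : R) (N : nat) (d : measure_display).
Variables (T : measurableType d) (P : probability T R).
Variable (A : T -> {set 'I_N.+1}).
Hypothesis A_bernoulli : bernoulli_random_subset P p A.

(** Independence is given for the events i \in A only; complements come in one
    at a time, by subtracting from the event for K minus a point k the part on
    which k \in A, that is, by moving k from K to J. *)
Lemma cylinder_law (J K : {set 'I_N.+1}) : [disjoint J & K]%B ->
  let X := [set w | (J \subset A w) && [disjoint K & A w]%B] in
  measurable X /\ P X = (p ^+ #|J| * (1 - p) ^+ #|K|)%:E.
Proof.
have [Em Ep Eind] := A_bernoulli.
elim: {K}#|K| {-2}K (erefl #|K|) J => [|c IHc] K cardK J JK X.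
  have K0 := cards0_eq cardK.
  have -> : X = \bigcap_(i in [set` J]) [set w | i \in A w].
    apply/seteqP; split=> w; rewrite /X /= K0.
      by case/andP=> /fintype.subsetP JA _ i /JA.
    move=> JA; rewrite finset.disjoints_subset finset.sub0set andbT.
    by apply/fintype.subsetP => i /JA.
  split; first exact: fin_bigcap_measurable.
  rewrite Eind (eq_bigr (fun=> p%:E)) // prodEFin prodr_const K0 finset.cards0.
  by rewrite expr0 mulr1.
have /card_gt0P[k kK] : (0 < #|K|)%N by rewrite cardK.
have cardK1 : #|(K :\ k)%SET| = c by move: cardK; rewrite (cardsD1 k) kK => -[].
have kJ : k \notin J by rewrite (disjointFl JK).
have JK1 : [disjoint J & (K :\ k)%SET]%B.
  by apply: disjointWr JK; exact: finset.subD1set.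
have kJK1 : [disjoint (k |: J)%SET & (K :\ k)%SET]%B.
  by rewrite disjoints_setU1 JK1 !inE eqxx.
have [X1m X1p] := IHc _ cardK1 _ JK1.
have [X2m X2p] := IHc _ cardK1 _ kJK1.
set X1 := [set w | _] in X1m X1p; set X2 := [set w | _] in X2m X2p.
have X21 : X2 `<=` X1.
  move=> w /= /andP[]; rewrite finset.subUset => /andP[_ JA] KA.
  by rewrite /X1 /= JA.
have -> : X = X1 `\` X2.
  have KA w :
      [disjoint K & A w]%B = (k \notin A w) && [disjoint (K :\ k)%SET & A w]%B.
    by rewrite -{1}(finset.setD1K kK) disjoints_setU1.
  apply/seteqP; split=> w; rewrite /X /X1 /X2 /= KA finset.subUset finset.sub1set.
    by case/and3P=> -> kA ->; split=> //; rewrite (negbTE kA).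
  by case=> /andP[-> ->]; rewrite !andbT /= => /negP.
split; first exact: measurableD.
have -> : P (X1 `\` X2) = (P X1 - P X2)%E.
  rewrite measureD // ?(setIidr X21) //.
  by rewrite (le_lt_trans (probability_le1 _ _)) ?ltry.
rewrite X1p X2p -EFinB cardsU1 kJ cardK cardK1 /=; congr EFin.
by rewrite add1n !exprS; ring.
Qed.

Lemma singleton_law (S : {set 'I_N.+1}) :
  measurable [set w | A w = S] /\ P [set w | A w = S] = (weight p S)%:E.
Proof.
have SC : [disjoint S & (~: S)%SET]%B
  by rewrite finset.disjoints_subset finset.setCK.
have [] := cylinder_law SC; set X := [set w | _].
have -> : X = [set w | A w = S].
  apply/seteqP; split=> w;
    rewrite /X /= finset.disjoints_subset finset.setCS -finset.eqEsubset.
    by rewrite eq_sym => /eqP.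
  by move=> ->.
move=> Xm ->; split=> //; congr EFin.
rewrite /weight (bigID (mem S)) /=; congr *%R.
  by rewrite (eq_bigr (fun=> p)) ?prodr_const // => i ->.
rewrite (eq_bigr (fun=> 1 - p)) => [|i /negbTE-> //].
rewrite prodr_const; congr (_ ^+ _); apply: eq_card => i.
by rewrite !inE.
Qed.

Lemma random_subset_law (Q : pred {set 'I_N.+1}) :
  P [set w | Q (A w)] = (prob p Q)%:E.
Proof.
have law s : uniq s -> measurable [set w | A w \in s] /\
    P [set w | A w \in s] = (\sum_(S <- s) weight p S)%:E.
  elim: s => [|S s IHs] /=.
    rewrite big_nil; have -> : [set w | A w \in [::]] = set0
      by apply/seteqP; split.
    by rewrite measure0.
  case/andP=> Ss /IHs[sm sP]; have [Sm SP] := singleton_law S.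
  have -> : [set w | A w \in S :: s] = [set w | A w = S] `|` [set w | A w \in s].
    apply/seteqP; split=> w; rewrite /= inE.
      by case/orP=> [/eqP|]; [left|right].
    by case=> ->; rewrite ?eqxx ?orbT.
  split; first exact: measurableU.
  rewrite big_cons EFinD -SP -sP; apply: measureU => //.
  by apply/seteqP; split=> w //= [-> /(negP Ss)].
have [_] := law (enum Q) (enum_uniq _); rewrite big_enum => <-.
by congr (P _); apply/seteqP; split=> w /=; rewrite mem_enum.
Qed.
End LawOfRandomSubset.

Theorem theorem2p4 (R : realType) (p : R) (hp0 : 0 < p) (hp1 : p < 1) (N : nat)
    (d : measure_display) (T : measurableType d) (P : probability T R)
    (A : T -> {set 'I_N.+1}) (hA : bernoulli_random_subset P p A)
    (m : nat) (hm : (m <= 2 * N)%N) :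
  `| fine (P [set w | missing (A w) = m])
     - \sum_(0 <= y < m.+1)
         fine (P [set w | missing_low (A w) = y])
         * fine (P [set w | missing_high (A w) = (m - y)%N]) |
  <= 8 / p ^+ 2 * ((1 - p ^+ 2) `^ (N%:R / 4)).
Proof.
have law (X : {set 'I_N.+1} -> nat) k :
    fine (P [set w | X (A w) = k]) = prob p (fun S => X S == k).
  rewrite -[RHS]/(fine _%:E) -(random_subset_law hA); congr (fine (P _)).
  by apply/seteqP; split=> w /= /eqP.
rewrite law; under eq_bigr do rewrite !law.
apply: le_trans (prob_missing_approx hp0 hp1 N m) _.
have p2_lt1 : p ^+ 2 < 1 by rewrite expr_lt1 // ltW.
have q_ge0 : 0 <= 1 - p ^+ 2 by rewrite subr_ge0 ltW.
apply: ler_wpM2l; first by rewrite divr_ge0 ?exprn_ge0 // ltW.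
rewrite -(powR_mulrn _ q_ge0); apply: ger_powR.
  by rewrite subr_gt0 p2_lt1 gerBl exprn_ge0 // ltW.
rewrite ler_pdivrMr // -natrM ler_nat; lia.
Qed.
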